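(* Let $n\ge1$, $0\le m\le n$, let $x_0,\dots,x_n$ be distinct floating-point numbers, let $\zeta$ be a floating-point number, and let the values $f(x_0),\dots,f(x_n)$ be floating-point numbers. Assume $(6n-m+4)u<1$. Let $w_{k,m}=\ell_k^{(m)}(\zeta)$, and suppose the weights $w_{k,m}$ are computed in floating-point arithmetic by the method of partial products described in the context and that the finite difference approximation $$\sum_{k=0}^n w_{k,m}f(x_k)$$ to $f^{(m)}(\zeta)$ is then computed from the computed weights. Then the magnitude of the roundoff error (the difference between the computed value and the exact value of this sum) is at most $$U_{\mathcal R}=\gamma_{6n-m+4}\,|f|\sum_{k=0}^n m!\,|w_k|\,S_{n-m}\bigl(\{|x_0-\zeta|,\ldots,|x_n-\zeta|\}-\{|x_k-\zeta|\}\bigr),$$ where $|f|=\max_j|f(x_j)|$ and $w_k$ is the exact Lagrange weight.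
   Context: $\ell_k(x)=\prod_{j\ne k}(x-x_j)/\prod_{j\ne k}(x_k-x_j)$ is the Lagrange cardinal function and $w_k=1/\prod_{j\neq k}(x_k-x_j)$ the Lagrange weight (indices $0\le j\le n$). $S_r$ denotes the elementary symmetric function of order $r$ (sum of all products of $r$ entries with distinct indices); $S_0=1$, also for an empty list. The notation $S_r(\{a_0,\dots,a_n\}-\{a_k\})$ means $S_r$ of the $n$ entries $a_j$, $j\ne k$. $\gamma_p=pu/(1-pu)$, defined when $pu<1$. Computation of the weights at $\zeta$. (i) $w_k$ is computed from its formula with the unshifted grid, using $n$ subtractions, $n-1$ multiplications and one division. (ii) The shifted points $z_j=x_j-\zeta$ are computed by one floating-point subtraction each. (iii) $w'_{k,m}$, the coefficient of $x^m$ in $\prod_{j\ne k}(x-z_j)$, is computed from the computed shifted points as $$w'_{k,m}=(-1)^{n-m}\sum_{m_1,m_2}S_{k-m_1}(z_0,\ldots,z_{k-1})\,S_{n-k-m_2}(z_{k+1},\ldots,z_n),$$ the sum being over nonnegative integers with $m_1+m_2=m$, $k-m_1\ge0$, $n-k-m_2\ge0$ (each term is formed with one multiplication, then the terms are added), where the symmetric functions are computed by the recurrence $$S_{N-m}(y_1,\ldots,y_N)=\begin{cases} y_N\,S_{N-1}(y_1,\ldots,y_{N-1}) & m=0,\\ S_{N-m}(y_1,\ldots,y_{N-1})+y_N\,S_{N-m-1}(y_1,\ldots,y_{N-1}) & N>m>0,\\ 1 & m=N,\end{cases}$$ corresponding to forming the products $\prod_{j=0}^{k-1}(x-z_j)$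 (from $j=0$ upwards) and $\prod_{j=k+1}^n(x-z_j)$ (from $j=n$ downwards) recursively. (iv) $w_{k,m}$ is computed as $m!\,w_k\,w'_{k,m}$ using two multiplications ($m!$ being regarded as an exactly known floating-point number). Finally, each term $w_{k,m}f(x_k)$ is formed with a single multiplication and the $n+1$ terms are added. Floating-point model: $u\in(0,1)$ is the unit roundoff. For floating-point numbers $x,y$ and $\mathrm{op}\in\{+,-,\times,/\}$, the computed result is $\mathrm{fl}(x\,\mathrm{op}\,y)=(x\,\mathrm{op}\,y)(1+\delta)$ for some $|\delta|\le u$; sign changes are exact. *)

(* Defs.v *)
From HB Require Import structures.
From mathcomp Require Export all_boot all_order all_algebra.
From mathcomp Require Export all_classical all_reals all_analysis.

Set Implicit Arguments.
Unset Strict Implicit.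
Unset Printing Implicit Defensive.

Import Order.TTheory GRing.Theory Num.Theory.

Local Open Scope ring_scope.

Variant fp_op := Add | Sub | Mul | Div.

Definition exact_op (R : realType) (o : fp_op) (a b : R) : R :=
  match o with
  | Add => a + b
  | Sub => a - b
  | Mul => a * b
  | Div => a / b
  end.

(* The standard model with unit roundoff u, without overflow or underflow.    *)
(* Negation is a real operation that preserves floating-point numbers, i.e.,  *)
(* sign changes are exact. Nothing is assumed about division by 0.            *)
Record fp_arith (R : realType) (u : R) := FpArith {
  fp_num : set R;
  fl : fp_op -> R -> R -> R;
  fp_num1 : fp_num 1;
  fp_numN : forall a, fp_num a -> fp_num (- a);
  fp_num_fl : forall o a b, fp_num a -> fp_num b -> (o = Div -> b != 0) ->
    fp_num (fl o a b);
  fl_model : forall o a b, fp_num a -> fp_num b -> (o = Div -> b != 0) ->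
    exists2 delta : R, `|delta| <= u & fl o a b = exact_op o a b * (1 + delta)
}.

Definition gamma (R : realType) (u : R) (p : nat) : R :=
  (p%:R * u) / (1 - p%:R * u).

Definition lagrange_weight (R : realType) (n : nat) (x : 'I_n.+1 -> R)
    (k : 'I_n.+1) : R :=
  1 / \prod_(j < n.+1 | j != k) (x k - x j).

Definition lagrange (R : realType) (n : nat) (x : 'I_n.+1 -> R)
    (k : 'I_n.+1) : R -> R :=
  fun t => \prod_(j < n.+1 | j != k) (t - x j) /
           \prod_(j < n.+1 | j != k) (x k - x j).

Definition fd_weight (R : realType) (n : nat) (x : 'I_n.+1 -> R) (m : nat)
    (zeta : R) (k : 'I_n.+1) : R :=
  derive1n m (lagrange x k) zeta.

(* Elementary symmetric function of order r of the entries (a i), i in P.     *)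
Definition esym (R : realType) (I : finType) (P : {set I}) (r : nat)
    (a : I -> R) : R :=
  \sum_(B : {set I} | (B \subset P) && (#|B| == r)) \prod_(i in B) a i.

(* fl_reduce A o s c: c is a result of combining the entries of the nonempty  *)
(* list s with (size s).-1 floating-point operations o, performed in any      *)
(* order and with any parenthesization.                                       *)
Inductive fl_reduce (R : realType) (u : R) (A : fp_arith u) (o : fp_op) :
    seq R -> R -> Prop :=
| fl_reduce_one a : fl_reduce A o [:: a] a
| fl_reduce_op s s1 s2 a b :
    perm_eq s (s1 ++ s2) -> fl_reduce A o s1 a -> fl_reduce A o s2 b ->
    fl_reduce A o s (fl A o a b).

Definition fl_lagrange_weight (R : realType) (u : R) (A : fp_arith u) (n : nat)
    (x : 'I_n.+1 -> R) (k : 'I_n.+1) (w : R) : Prop :=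
  exists2 d, fl_reduce A Mul
      [seq fl A Sub (x k) (x j) | j <- enum 'I_n.+1 & j != k] d
    & w = fl A Div 1 d.

(* For m <= N, the computed S_{N-m}(y_1, ..., y_N), with y_(i+1) stored as    *)
(* y i; the second argument is the power m of the variable and not the order  *)
(* N - m of the symmetric function. Multiplications by S_0 = 1 are performed  *)
(* as floating-point operations.                                              *)
Fixpoint fl_esym (R : realType) (u : R) (A : fp_arith u) (y : nat -> R)
    (N m : nat) : R :=
  if m == N then 1 else
  match N, m with
  | 0, _ => 1
  | N'.+1, 0 => fl A Mul (y N') (fl_esym A y N' 0)
  | N'.+1, m'.+1 =>
      fl A Add (fl_esym A y N' m') (fl A Mul (y N') (fl_esym A y N' m))
  end.

(* The second factor is built from j = n downwards: its i-th entry, counting  *)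
(* from 0, is z (n - i), and its last one is z k.+1.                          *)
Definition fl_partial_terms (R : realType) (u : R) (A : fp_arith u)
    (z : nat -> R) (n k m : nat) : seq R :=
  [seq fl A Mul (fl_esym A z k m1)
                (fl_esym A (fun i => z (n - i)%N) (n - k) (m - m1))
     | m1 <- iota 0 m.+1 & (m1 <= k)%N && (m - m1 <= n - k)%N].

Definition fl_partial_coef (R : realType) (u : R) (A : fp_arith u)
    (z : nat -> R) (n k m : nat) (w' : R) : Prop :=
  exists2 s, fl_reduce A Add (fl_partial_terms A z n k m) s
    & w' = (-1) ^+ (n - m) * s.

Definition fl_shift (R : realType) (u : R) (A : fp_arith u) (n : nat)
    (x : 'I_n.+1 -> R) (zeta : R) (j : nat) : R :=
  fl A Sub (x (inord j)) zeta.

Definition fl_fd_weight (R : realType) (u : R) (A : fp_arith u) (n : nat)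
    (x : 'I_n.+1 -> R) (m : nat) (zeta : R) (k : 'I_n.+1) (W : R) : Prop :=
  exists w w' : R,
    [/\ fl_lagrange_weight A x k w,
        fl_partial_coef A (fl_shift A x zeta) n k m w'
      & fl_reduce A Mul [:: m`!%:R; w; w'] W].

Definition fl_fd_approx (R : realType) (u : R) (A : fp_arith u) (n : nat)
    (W : 'I_n.+1 -> R) (fx : 'I_n.+1 -> R) (v : R) : Prop :=
  fl_reduce A Add [seq fl A Mul (W k) (fx k) | k <- enum 'I_n.+1] v.

(* Main.v *)
Require Import Defs.
From mathcomp Require Import zify ring lra.
Import Order.TTheory GRing.Theory Num.Theory.
Local Open Scope ring_scope.

(** The exact weight is [m! w_k] times the coefficient of [X^m] in
    [prod_(j != k) (X - z_j)], with [z_j = x_j - zeta] ([fd_weightE]). Up to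
    the sign [(-1)^(n-m)], that coefficient is the elementary symmetric function
    [S_(n-m)] of the [z_j], a sum of products. Hence the computed sum is the
    exact one with each elementary product multiplied by rounding factors
    [1 + delta], or by inverses of such factors for those in the denominator of
    [w_k]. If each product carries at most [p] factors, the error is at most
    [(1 - u)^-p - 1 <= gamma_p] times the sum of the absolute values of the
    products. Replacing every [z_j] by [|z_j|] gives exactly that sum.

    The factors are not written out. The relation [approx A p c e M] keeps
    only the consequence: [c] is within [((1 - u)^-p - 1) M] of [e], and [M]
    majorizes [e]. It is stable under floating-point operations
    ([approx_mul], [approx_add]) and thus under iterated ones in any order
    ([approx_sum], [approx_prod]). The denominator of [w_k] needs a bound on
    the quotient [c / e] from below as well as from above, because it is
    inverted; this is [relerr]. Both 1 + delta and its inverse lie between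
    [1 - u] and [(1 - u)^-1], so inversion preserves the bounds.

    It remains to count.
    - [w_k]: [n] subtractions, [n - 1] multiplications and a division, [2 n].
    - A term of [S_(N-m)]: [N - m] subtractions, [N - m] multiplications and at
      most [N - 1] additions ([approx_fl_esym]).
    - A product of two such functions, of [k] and [n - k] points: at most
      [2 (n - m) + (n - 1)] if one side is empty and one less otherwise, plus
      one multiplication, hence at most [3 n - 2 m]. The convolution has at
      most [m + 1] terms, which adds [m]: at most [3 n - m]
      ([approx_fl_partial_coef]).
    - The two multiplications by [m!] and [w_k], the one by [f (x_k)], and the
      [n] additions of the final sum contribute [n + 3].
    The total is [2 n + (3 n - m) + (n + 3) = 6 n - m + 3]. *)

(** * Powers of [1 - u] and the constants gamma *)

Lemma bernoulli_ge {R : realType} {u : R} p : 0 < u < 1 -> 1 - p%:R * u <= (1 - u) ^+ p.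
Proof.
move=> u01; elim: p => [|p IHp]; first by rewrite mul0r subr0 expr0.
have p0 : (0 : R) <= p%:R by [].
have v0 : 0 <= 1 - u by lra.
apply: (le_trans _ (_ : (1 - p%:R * u) * (1 - u) <= _)).
  have -> : (p.+1%:R : R) = p%:R + 1 by rewrite -natr1.
  by nra.
by rewrite exprSr; apply: ler_wpM2r.
Qed.

(** Growth factors [(1 - u)^-p] multiply exactly, which makes them better suited
    to the induction over operations than the [gamma u p]; this inequality is
    where [p u < 1] enters. *)
Lemma growth_le_gamma {R : realType} {u : R} p : 0 < u < 1 -> p%:R * u < 1 ->
  (1 - u) ^- p - 1 <= gamma u p.
Proof.
move=> u01 pu1; have d0 : 0 < 1 - p%:R * u by lra.
have -> : gamma u p = (1 - p%:R * u)^-1 - 1 by rewrite /gamma; field; lra.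
rewrite lerD2r lef_pV2 ?posrE //; first exact: bernoulli_ge.
by apply: lt_le_trans d0 _; exact: bernoulli_ge.
Qed.

Lemma growth_mono {R : realType} {u : R} {p q} : 0 < u < 1 -> (p <= q)%N ->
  (1 - u) ^- p <= (1 - u) ^- q.
Proof.
move=> u01 pq; have v0 : 0 < 1 - u by lra.
rewrite lef_pV2 ?posrE ?exprn_gt0 //.
by apply: ler_wiXn2l => //; lra.
Qed.

Lemma growth_ge1 {R : realType} {u : R} p : 0 < u < 1 -> 1 <= (1 - u) ^- p.
Proof. by move=> u01; have := growth_mono u01 (leq0n p); rewrite expr0 invr1. Qed.

Lemma growthD {R : realType} {u : R} p q :
  (1 - u) ^- (p + q) = (1 - u) ^- p * (1 - u) ^- q.
Proof. by rewrite exprD invfM mulrC. Qed.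

Lemma round_factor {R : realType} {u delta : R} : 0 < u < 1 -> `|delta| <= u ->
  1 - u <= 1 + delta <= (1 - u)^-1.
Proof.
move=> u01; rewrite ler_norml => /andP[d1 d2].
have v0 : 0 < 1 - u by lra.
have : 1 + u <= (1 - u)^-1 by rewrite -[leRHS]mul1r ler_pdivlMr //; nra.
by move=> h; apply/andP; split; lra.
Qed.

(** * Absolute error relative to a majorant *)

(** [p] counts the rounding errors accumulated by [c], a computed value of [e].
    The majorant [M] stands for the value of the expression of [e] with all its
    entries replaced by absolute values. The bound is relative to [M] and not to
    [|e|], since only the former survives cancellation in sums. *)
Definition approx {R : realType} {u : R} (A : fp_arith u) (p : nat) (c e M : R) :=
  [/\ fp_num A c, `|e| <= M & `|c - e| <= ((1 - u) ^- p - 1) * M].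

Lemma approx_exact {R : realType} {u : R} (A : fp_arith u) p c :
  0 < u < 1 -> fp_num A c -> approx A p c c `|c|.
Proof.
move=> u01 c_fp; split=> //; rewrite subrr normr0 mulr_ge0 //.
by rewrite subr_ge0 growth_ge1.
Qed.

Lemma approx_mono {R : realType} {u : R} {A : fp_arith u} {p q c e M} :
  0 < u < 1 -> (p <= q)%N -> approx A p c e M -> approx A q c e M.
Proof.
move=> u01 pq [c_fp eM ceM]; split=> //; apply: (le_trans ceM).
apply: ler_wpM2r; first exact: le_trans eM.
by rewrite lerD2r growth_mono.
Qed.

Lemma approx_sign {R : realType} {u : R} {A : fp_arith u} {p c e M} r :
  approx A p c e M -> approx A p ((-1) ^+ r * c) ((-1) ^+ r * e) M.
Proof.
move=> [c_fp eM ceM]; split.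
- by rewrite -signr_odd; case: odd; rewrite ?expr0 ?expr1 ?mul1r ?mulN1r //; apply: fp_numN.
- by rewrite normrM normrX normrN1 expr1n mul1r.
- by rewrite -mulrBr normrM normrX normrN1 expr1n mul1r.
Qed.

(** One rounding turns the growth factor [r] into [r / (1 - u)]: the old error is
    multiplied by at most [(1 - u)^-1], and the new one is at most
    [u M <= ((1 - u)^-1 - 1) M]. *)
Lemma approx_round {R : realType} {u : R} {p : nat} {s e M delta : R} :
  0 < u < 1 -> `|delta| <= u -> `|e| <= M ->
  `|s - e| <= ((1 - u) ^- p - 1) * M ->
  `|s * (1 + delta) - e| <= ((1 - u) ^- p.+1 - 1) * M.
Proof.
move=> u01 du eM seM.
have /andP[r1 r2] := round_factor u01 du.
have v0 : 0 < 1 - u by lra.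
have -> : s * (1 + delta) - e = (s - e) * (1 + delta) + e * delta by ring.
apply: le_trans (ler_normD _ _) _; rewrite !normrM.
have -> : ((1 - u) ^- p.+1 - 1) * M =
   ((1 - u) ^- p - 1) * M * (1 - u)^-1 + M * ((1 - u)^-1 - 1).
  by rewrite -addn1 growthD expr1; ring.
apply: lerD; apply: ler_pM => //.
  by rewrite ger0_norm //; lra.
apply: (le_trans du); rewrite lerBrDr addrC.
by rewrite -[leRHS]mul1r ler_pdivlMr //; nra.
Qed.

Lemma approx_mul {R : realType} {u : R} {A : fp_arith u} {p q c d e f M N} :
  0 < u < 1 -> approx A p c e M -> approx A q d f N ->
  approx A (p + q).+1 (fl A Mul c d) (e * f) (M * N).
Proof.
move=> u01 [c_fp eM ceM] [d_fp fN dfN].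
have [|delta du flE] := fl_model c_fp d_fp (o := Mul); first by [].
have efMN : `|e * f| <= M * N by rewrite normrM ler_pM.
split=> //; first exact: (fp_num_fl c_fp d_fp).
rewrite flE; apply: approx_round => //=.
have -> : c * d - e * f = (c - e) * (d - f) + (c - e) * f + e * (d - f) by ring.
rewrite growthD; move: ((1 - u) ^- p) ((1 - u) ^- q) ceM dfN => a b ceM dfN.
have -> : (a * b - 1) * (M * N) = (a - 1) * M * ((b - 1) * N) + (a - 1) * M * N
   + M * ((b - 1) * N) by ring.
apply: le_trans (ler_normD _ _) _; apply: lerD; last by rewrite normrM ler_pM.
by apply: le_trans (ler_normD _ _) _; apply: lerD; rewrite normrM ler_pM.
Qed.

Lemma approx_add {R : realType} {u : R} {A : fp_arith u} {p c d e f M N} :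
  0 < u < 1 -> approx A p c e M -> approx A p d f N ->
  approx A p.+1 (fl A Add c d) (e + f) (M + N).
Proof.
move=> u01 [c_fp eM ceM] [d_fp fN dfN].
have [|delta du flE] := fl_model c_fp d_fp (o := Add); first by [].
have efMN : `|e + f| <= M + N by apply: le_trans (ler_normD _ _) _; exact: lerD.
split=> //; first exact: (fp_num_fl c_fp d_fp).
rewrite flE; apply: approx_round => //=.
have -> : c + d - (e + f) = (c - e) + (d - f) by ring.
by rewrite mulrDr; apply: le_trans (ler_normD _ _) _; exact: lerD.
Qed.

Lemma approx_sub_exact {R : realType} {u : R} {A : fp_arith u} {a b} :
  0 < u < 1 -> fp_num A a -> fp_num A b ->
  approx A 1 (fl A Sub a b) (a - b) `|a - b|.
Proof.
move=> u01 a_fp b_fp.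
have [|delta du flE] := fl_model a_fp b_fp (o := Sub); first by [].
split=> //; first exact: (fp_num_fl a_fp b_fp).
by rewrite flE; apply: approx_round => //=; rewrite subrr normr0 expr0 invr1 subrr mul0r.
Qed.

(** * Relative error, for products and quotients *)

(** The bounds are symmetric under inversion, so that a divisor may carry errors;
    [approx] would not even prevent the computed divisor from vanishing. *)
Definition relerr {R : realType} {u : R} (A : fp_arith u) (p : nat) (c e : R) :=
  fp_num A c /\
  exists2 t, (1 - u) ^+ p <= t <= (1 - u) ^- p & c = e * t.

Lemma relerr_fl {R : realType} {u : R} {A : fp_arith u} {p : nat} {o a b e t} :
  0 < u < 1 -> fp_num A a -> fp_num A b -> (o = Div -> b != 0) ->
  exact_op o a b = e * t -> (1 - u) ^+ p <= t <= (1 - u) ^- p ->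
  relerr A p.+1 (fl A o a b) e.
Proof.
move=> u01 a_fp b_fp b0 abE /andP[t1 t2].
have [delta du flE] := fl_model a_fp b_fp b0.
split; first exact: (fp_num_fl a_fp b_fp b0).
have v0 : 0 < 1 - u by lra.
have /andP[r1 r2] := round_factor u01 du.
exists (t * (1 + delta)); last by rewrite flE abE mulrA.
have vp := exprn_gt0 p v0.
rewrite -addn1 growthD exprD expr1.
by apply/andP; split; apply: ler_pM => //; lra.
Qed.

Lemma relerr_sub {R : realType} {u : R} {A : fp_arith u} {a b} :
  0 < u < 1 -> fp_num A a -> fp_num A b ->
  relerr A 1 (fl A Sub a b) (a - b).
Proof.
move=> u01 a_fp b_fp; apply: (@relerr_fl _ _ _ _ _ _ _ _ 1) => //.
  by rewrite mulr1.
by rewrite expr0 invr1 lexx.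
Qed.

Lemma relerr_mul {R : realType} {u : R} {A : fp_arith u} {p q a b e f} :
  0 < u < 1 -> relerr A p a e -> relerr A q b f ->
  relerr A (p + q).+1 (fl A Mul a b) (e * f).
Proof.
move=> u01 [a_fp [s /andP[s1 s2] aE]] [b_fp [t /andP[t1 t2] bE]].
have v0 : 0 < 1 - u by lra.
have := exprn_gt0 p v0; have := exprn_gt0 q v0 => vq vp.
apply: (@relerr_fl _ _ _ _ _ _ _ _ (s * t)) => //.
  by rewrite /= aE bE mulrACA.
by rewrite growthD exprD; apply/andP; split; apply: ler_pM => //; lra.
Qed.

Lemma relerr_inv {R : realType} {u : R} {A : fp_arith u} {p d e} :
  0 < u < 1 -> e != 0 -> relerr A p d e ->
  relerr A p.+1 (fl A Div 1 d) (1 / e).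
Proof.
move=> u01 e0 [d_fp [t /andP[t1 t2] dE]].
have v0 : 0 < 1 - u by lra.
have vp := exprn_gt0 p v0.
have t0 : 0 < t by lra.
apply: (@relerr_fl _ _ _ _ _ _ _ _ t^-1) => //.
- exact: fp_num1.
- by move=> _; rewrite dE mulf_neq0 // gt_eqF.
- by rewrite /= dE !mul1r invfM mulrC.
- rewrite -[X in X <= _]invrK !lef_pV2 ?posrE ?invr_gt0 //.
  by rewrite t2 t1.
Qed.

Lemma relerr_approx {R : realType} {u : R} {A : fp_arith u} {p c e} :
  0 < u < 1 -> relerr A p c e -> approx A p c e `|e|.
Proof.
move=> u01 [c_fp [t /andP[t1 t2] cE]]; split=> //.
have v0 : 0 < 1 - u by lra.
have vp := exprn_gt0 p v0.
rewrite cE -[X in _ - X]mulr1 -mulrBr normrM mulrC ler_wpM2r //.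
rewrite ler_norml; apply/andP; split; last by rewrite lerD2r.
have : (1 - u) ^+ p * (1 - u) ^- p = 1 by rewrite divff // gt_eqF.
have : 0 < (1 - u) ^- p by rewrite invr_gt0.
by move: ((1-u) ^+ p) ((1 - u) ^- p) t1 t2 vp => a b ? ? ? ? ?; nra.
Qed.

(** * Iterated operations in arbitrary order *)

Lemma perm_map_inv {I T : eqType} (f : I -> T) (r : seq I) (t : seq T) :
  perm_eq (map f r) t -> exists2 r', perm_eq r r' & t = map f r'.
Proof.
case: r => [|i0 r].
  by rewrite perm_sym => /perm_nilP ->; exists [::].
set s := i0 :: r; rewrite perm_sym => /(perm_iotaP (f i0))[Is pIs ->].
exists (map (nth i0 s) Is).
  by rewrite perm_sym; apply/(perm_iotaP i0); exists Is; rewrite // -(size_map f).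
rewrite -map_comp; apply/eq_in_map => i.
rewrite (perm_mem pIs) mem_iota add0n size_map => i_s.
exact: nth_map.
Qed.

(** Equal computed entries may approximate different exact values, so a
    reduction is followed on the list of indices of its entries and not on the
    list of the entries themselves. *)
Lemma fl_reduce_map_ind {R : realType} {u : R} {A : fp_arith u} {o : fp_op}
    {I : eqType} {c : I -> R} {Q : pred I} (P : seq I -> R -> Prop) :
  (forall i, Q i -> P [:: i] (c i)) ->
  (forall r r' a, perm_eq r r' -> P r a -> P r' a) ->
  (forall r1 r2 a b, P r1 a -> P r2 b -> P (r1 ++ r2) (fl A o a b)) ->
  forall r v, all Q r -> fl_reduce A o (map c r) v -> P r v.
Proof.
move=> P1 Pperm Pcat r v Qr; move Es: (map c r) => s red.
elim: red r Qr Es => {s v} [a|s s1 s2 a b s12 _ IH1 _ IH2] r Qr.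
  by case: r Qr => [|i [|]] //= /andP[Qi _] [<-]; apply: P1.
move=> rs; rewrite -rs in s12; have [r' rr' r'E] := perm_map_inv _ _ _ s12.
apply: (Pperm r'); first by rewrite perm_sym.
have Qr' : all Q r' by rewrite -(perm_all _ rr').
rewrite -(cat_take_drop (size s1) r') in Qr' r'E *.
move: Qr'; rewrite all_cat => /andP[Q1 Q2].
have sz : (size s1 <= size r')%N.
  by move: (congr1 size r'E); rewrite map_cat !size_cat !size_map size_take size_drop; case: ltnP; lia.
move/eqP: r'E; rewrite map_cat eqseq_cat; last by rewrite size_map size_takel.
by case/andP=> /eqP e1 /eqP e2; apply: Pcat; [apply: IH1|apply: IH2].
Qed.

(** A sum of [l] terms has [l - 1] additions, and each term goes through at most
    all of them, whatever the parenthesization. *)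
Lemma approx_sum {R : realType} {u : R} {A : fp_arith u} {I : eqType} {p : nat}
    {c e M : I -> R} {r : seq I} {v} :
  0 < u < 1 -> {in r, forall i, approx A p (c i) (e i) (M i)} ->
  fl_reduce A Add (map c r) v ->
  approx A (p + (size r).-1) v (\sum_(i <- r) e i) (\sum_(i <- r) M i).
Proof.
move=> u01 ceM red.
pose P r a := (0 < size r)%N /\
  approx A (p + (size r).-1) a (\sum_(i <- r) e i) (\sum_(i <- r) M i).
suff [] : P r v by [].
apply: (fl_reduce_map_ind (Q := mem r)) red.
- by move=> i ir; split=> //; rewrite !big_seq1 addn0; apply: ceM.
- by move=> r1 r2 a r12; rewrite /P (perm_size r12) !(perm_big _ r12).
- move=> r1 r2 a b [r1_gt0 ar1] [r2_gt0 br2]; rewrite /P size_cat !big_cat /=.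
  split; first by rewrite addn_gt0 r1_gt0.
  pose q := (p + maxn (size r1).-1 (size r2).-1)%N.
  apply: (@approx_mono _ _ _ q.+1) => //; first by rewrite /q; lia.
  by apply: approx_add => //; [apply: approx_mono ar1|apply: approx_mono br2];
    rewrite // /q; lia.
- exact/allP.
Qed.

Lemma relerr_prod {R : realType} {u : R} {A : fp_arith u} {I : eqType} {p : nat}
    {c e : I -> R} {r : seq I} {v} :
  0 < u < 1 -> {in r, forall i, relerr A p (c i) (e i)} ->
  fl_reduce A Mul (map c r) v ->
  (0 < size r)%N /\ relerr A (size r * p.+1).-1 v (\prod_(i <- r) e i).
Proof.
move=> u01 ce red.
pose P r a := (0 < size r)%N /\ relerr A (size r * p.+1).-1 a (\prod_(i <- r) e i).
suff [] : P r v by [].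
apply: (fl_reduce_map_ind (Q := mem r)) red.
- by move=> i ir; split=> //; rewrite !big_seq1 mul1n; apply: ce.
- by move=> r1 r2 a r12; rewrite /P (perm_size r12) !(perm_big _ r12).
- move=> r1 r2 a b [r1_gt0 ar1] [r2_gt0 br2]; rewrite /P size_cat !big_cat /=.
  split; first by rewrite addn_gt0 r1_gt0.
  have -> : ((size r1 + size r2) * p.+1).-1 =
            ((size r1 * p.+1).-1 + (size r2 * p.+1).-1).+1 by nia.
  exact: relerr_mul.
- exact/allP.
Qed.

Lemma approx_prod {R : realType} {u : R} {A : fp_arith u} {I : eqType}
    {p : I -> nat} {c e M : I -> R} {r : seq I} {v} :
  0 < u < 1 -> {in r, forall i, approx A (p i) (c i) (e i) (M i)} ->
  fl_reduce A Mul (map c r) v ->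
  approx A (\sum_(i <- r) (p i).+1).-1 v (\prod_(i <- r) e i) (\prod_(i <- r) M i).
Proof.
move=> u01 ceM red.
pose P r a := (0 < \sum_(i <- r) (p i).+1)%N /\
  approx A (\sum_(i <- r) (p i).+1).-1 a (\prod_(i <- r) e i) (\prod_(i <- r) M i).
suff [] : P r v by [].
apply: (fl_reduce_map_ind (Q := mem r)) red.
- by move=> i ir; rewrite /P !big_seq1; split=> //; apply: ceM.
- by move=> r1 r2 a r12; rewrite /P !(perm_big _ r12).
- move=> r1 r2 a b [r1_gt0 ar1] [r2_gt0 br2]; rewrite /P !big_cat /=.
  split; first by rewrite addn_gt0 r1_gt0.
  set s1 := (\sum_(i <- r1) _)%N in r1_gt0 ar1 *; set s2 := (\sum_(i <- r2) _)%N in r2_gt0 br2 *.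
  have -> : (s1 + s2).-1 = (s1.-1 + s2.-1).+1 by lia.
  exact: approx_mul.
- exact/allP.
Qed.

(** * Elementary symmetric functions as coefficients *)

Lemma size_prod_XaddC {R : realType} (a : nat -> R) N :
  size (\prod_(i < N) ('X + (a i)%:P)) = N.+1.
Proof.
rewrite (eq_bigr (fun i : 'I_N => 'X - (- a i)%:P)); last by move=> i _; rewrite polyCN opprK.
by rewrite size_prod_XsubC /index_enum -enumT size_enum_ord.
Qed.

Lemma coef_top_prod_XaddC {R : realType} (a : nat -> R) N :
  (\prod_(i < N) ('X + (a i)%:P))`_N = 1.
Proof.
rewrite -[X in _`_X]/(N.+1.-1) -(size_prod_XaddC a N) -/(lead_coef _).
rewrite (eq_bigr (fun i : 'I_N => 'X - (- a i)%:P)); last by move=> i _; rewrite polyCN opprK.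
exact: lead_coef_prod_XsubC.
Qed.

(** The recurrence for the symmetric functions is multiplication by
    [X + y_N] read on coefficients. The majorant satisfies the same recurrence
    with [M] in place of [e]. In the error count, each of the [N - m] entries of
    a product brings its own [q] errors and a multiplication. The recurrence
    has at most [N] steps, and it takes all [N] only when it ends on a step with
    [m = 0], which has no addition: at most [N - 1] additions. *)
Lemma approx_fl_esym {R : realType} {u : R} {A : fp_arith u} {q N m : nat}
    {y e M : nat -> R} :
  0 < u < 1 -> (forall i, (i < N)%N -> approx A q (y i) (e i) (M i)) ->
  (m <= N)%N ->
  approx A ((N - m) * q.+1 + N.-1) (fl_esym A y N m)
    (\prod_(i < N) ('X + (e i)%:P))`_m (\prod_(i < N) ('X + (M i)%:P))`_m.
Proof.
move=> u01; elim: N m => [|N IHN] m yeM.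
  rewrite leqn0 => /eqP ->; rewrite !big_ord0 coef1 /=.
  by have := approx_exact A 0 _ u01 (fp_num1 A); rewrite normr1.
have {}IHN m' : (m' <= N)%N -> _ := IHN m' (fun i iN => yeM i (leqW iN)).
rewrite leq_eqVlt => /orP[/eqP ->|].
  rewrite !coef_top_prod_XaddC /= eqxx.
  by have := approx_exact A _ _ u01 (fp_num1 A); rewrite normr1; apply.
rewrite ltnS => mN; have yN := yeM N (ltnSn N).
rewrite !big_ord_recr /= ltn_eqF //.
case: m mN => [|m] mN.
  rewrite !mulrDr !coefD !coefMX !coefMC /= !add0r ![_`_0 * _]mulrC.
  apply: approx_mono (approx_mul u01 yN (IHN 0%N mN)) => //.
  by rewrite subn0; nia.
rewrite !mulrDr !coefD !coefMX !coefMC /= ![_`_m.+1 * _]mulrC.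
pose p := ((N - m) * q.+1 + N.-1)%N.
apply: (@approx_mono _ _ _ p.+1) => //; first by rewrite /p; nia.
apply: approx_add => //; first exact/IHN/ltnW.
by apply: approx_mono (approx_mul u01 yN (IHN m.+1 mN)) => //; rewrite /p; nia.
Qed.

(** Expanding the product chooses, for each [i] in [P], either [a i] or [X]. The
    summation runs over all subsets [J] of the index type; giving the indices
    outside [P] the factor [0 + 1] kills the [J] not included in [P]. *)
Lemma coef_prod_XaddC {R : realType} {I : finType} (P : {set I}) (a : I -> R) m :
  (m <= #|P|)%N ->
  (\prod_(i in P) ('X + (a i)%:P))`_m = esym P (#|P| - m) a.
Proof.
move=> mP; rewrite big_mkcond /=.
rewrite (eq_bigr (fun i => (if i \in P then (a i)%:P else 0) + (if i \in P then 'X else 1)));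
  last by move=> i _; case: ifP; rewrite ?add0r // addrC.
rewrite bigA_distr coef_sum /esym [RHS]big_mkcond /=; apply: eq_bigr => J _.
have [JP|] := boolP (J \subset P); last first.
  case/fintype.subsetPn => i iJ iP; rewrite (bigD1 i) //= iJ (negbTE iP) mul0r.
  by rewrite coef0.
rewrite (bigID (mem J)) /=.
rewrite (eq_bigr (fun i => (a i)%:P)); last first.
  by move=> i iJ; rewrite iJ (fintype.subsetP JP).
rewrite [X in _ * X](_ : _ = 'X^(#|P| - #|J|)); last first.
  rewrite (eq_bigr (fun i => if i \in P then 'X else 1)); last by move=> i /negbTE ->.
  rewrite -big_mkcondr /= -cardsDS //.
  rewrite (eq_bigl (mem (P :\: J))) ?prodr_const // => i.
  by rewrite !inE.
rewrite -rmorph_prod coefCM coefXn /=.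
have JPc := subset_leq_card JP.
have -> : (m == #|P| - #|J|)%N = (#|J| == #|P| - m)%N by apply/eqP/eqP; lia.
by case: eqP => _; rewrite ?mulr1 ?mulr0.
Qed.

(** The points of index above [k] are enumerated from [n] downwards, as in the
    computation of the second partial product. *)
Lemma prod_partial {T : comNzRingType} (n : nat) (k : 'I_n.+1) (F : nat -> T) :
  \prod_(i < k) F i * \prod_(i < n - k) F (n - i)%N =
  \prod_(j in [set~ k]) F j.
Proof.
have kn : (k <= n)%N by rewrite -ltnS.
have -> : \prod_(j in [set~ k]) F j = \prod_(0 <= j < n.+1 | j != k) F j.
  by rewrite big_mkord; apply: eq_bigl => j; rewrite !inE.
rewrite (@big_cat_nat _ _ _ k) //=; last exact: leqW.
rewrite [X in _ = _ * X]big_ltn_cond // eqxx; congr (_ * _).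
  rewrite big_nat_cond [RHS]big_nat_cond -!(big_mkord xpredT) /= big_nat_cond.
  by apply: eq_bigl => i; case: ltngtP => //=; rewrite ?andbF.
rewrite -(big_mkord xpredT (fun i => F (n - i)%N)) big_nat_rev /= add0n.
rewrite -[in RHS](add0n k.+1) big_addn subSS big_nat_cond [RHS]big_nat_cond.
apply: eq_big => i.
  by rewrite andbT; case: (i < n - k)%N => //=; rewrite neq_ltn; lia.
by case/andP => /andP[_ ink] _; congr F; lia.
Qed.

Lemma esymN {R : realType} {I : finType} (P : {set I}) r (a : I -> R) :
  esym P r (fun i => - a i) = (-1) ^+ r * esym P r a.
Proof.
rewrite /esym mulr_sumr; apply: eq_bigr => J /andP[_ /eqP <-].
by rewrite prodrN.
Qed.

Lemma esym_norm_ge0 {R : realType} {I : finType} (P : {set I}) r (a : I -> R) :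
  0 <= esym P r (fun i => `|a i|).
Proof. by apply: sumr_ge0 => J _; apply: prodr_ge0. Qed.

(** * The computed weights *)

(** The convolution of the two families of symmetric functions is the
    coefficient of a product of polynomials; the terms left out of the computed
    sum are those where one of the coefficients lies above the degree. *)
Lemma approx_fl_partial_coef {R : realType} {u : R} {A : fp_arith u} {n m : nat}
    {k : 'I_n.+1} {z e : nat -> R} {w' : R} :
  0 < u < 1 -> (0 < n)%N -> (m <= n)%N ->
  (forall i, (i <= n)%N -> approx A 1 (z i) (e i) `|e i|) ->
  fl_partial_coef A z n k m w' ->
  approx A (3 * n - m) w' ((-1) ^+ (n - m) * esym [set~ k] (n - m) e)
    (esym [set~ k] (n - m) (fun j => `|e j|)).
Proof.
rewrite /fl_partial_coef /fl_partial_terms.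
move=> u01 n0 mn ze [s red ->]; apply: approx_sign.
have kn : (k <= n)%N by rewrite -ltnS.
have cardP : #|[set~ k]| = n by rewrite cardsC1 card_ord.
(* Used for the exact value with F = e, and for the majorant with F = |e|. *)
have coefE (F : nat -> R) : esym [set~ k] (n - m) F =
  \sum_(i <- [seq i <- iota 0 m.+1 | (i <= k)%N && (m - i <= n - k)%N])
    (\prod_(j < k) ('X + (F j)%:P))`_i *
    (\prod_(j < n - k) ('X + (F (n - j)%N)%:P))`_(m - i).
  have := coef_prod_XaddC [set~ k] (fun j => F j) m; rewrite cardP => <- //.
  rewrite -(prod_partial _ _ (fun j => 'X + (F j)%:P)) coefM.
  rewrite -(big_mkord xpredT (fun i => _`_i * _`_(m - i))).
  rewrite big_filter [RHS]big_mkcond /index_iota subn0; apply: eq_bigr => i _.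
  case: ifP => // /negbT; rewrite negb_and -!ltnNge => /orP[ki|nki].
    by rewrite nth_default ?mul0r // size_prod_XaddC.
  by rewrite mulrC nth_default ?mul0r // (size_prod_XaddC (fun j => F (n - j)%N)).
rewrite (coefE e) (coefE (fun j => `|e j|)).
set r := [seq i <- _ | _] in red *.
(* Error count of one term of the convolution. *)
pose q := (3 * n - 2 * m)%N.
have szr : (size r <= m.+1)%N by rewrite -[m.+1](size_iota 0) size_filter count_size.
apply: (@approx_mono _ _ _ (q + (size r).-1)) => //; first by rewrite /q; lia.
apply: approx_sum red => // i; rewrite mem_filter => /andP[/andP[ik mik]].
rewrite mem_iota add0n /= ltnS => im.
have lo : forall j, (j < k)%N -> approx A 1 (z j) (e j) `|e j|.
  by move=> j jk; apply: ze; lia.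
have hi : forall j, (j < n - k)%N -> approx A 1 (z (n - j)%N) (e (n - j)%N) `|e (n - j)%N|.
  by move=> j jk; apply: ze; lia.
apply: approx_mono (approx_mul u01 (approx_fl_esym u01 lo ik) (@approx_fl_esym _ _ _ _ _ _ _ (fun j => e (n - j)%N) (fun j => `|e (n - j)%N|) u01 hi mik)) => //.
by rewrite /q; lia.
Qed.

(** * The exact weights *)

Lemma derivn_comp_shift {R : realType} (p : {poly R}) c m :
  (p \Po ('X - c%:P))^`(m) = p^`(m) \Po ('X - c%:P).
Proof.
elim: m => [|m IHm]; first by rewrite !derivn0.
by rewrite !derivnS IHm deriv_comp derivB derivX derivC subr0 mulr1.
Qed.

Lemma derive1n_horner {R : realType} (p : {poly R}) m :
  derive1n m (horner p) = horner p^`(m).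
Proof.
elim: m => [|m IHm]; first by rewrite derive1n0 derivn0.
by rewrite derive1nS IHm derivnS derivE.
Qed.

(** Translating by [zeta] makes the derivative at [zeta] a derivative at 0,
    which reads off a coefficient. *)
Lemma fd_weightE {R : realType} {n m : nat} (x : 'I_n.+1 -> R) zeta k :
  (m <= n)%N ->
  fd_weight x m zeta k = m`!%:R * lagrange_weight x k *
    ((-1) ^+ (n - m) * esym [set~ k] (n - m) (fun j => x j - zeta)).
Proof.
move=> mn; have cardP : #|[set~ k]| = n by rewrite cardsC1 card_ord.
pose Q := \prod_(j in [set~ k]) ('X + (- (x j - zeta))%:P).
have lagE : lagrange x k = horner (lagrange_weight x k *: (Q \Po ('X - zeta%:P))).
  apply/funext => t; rewrite hornerZ horner_comp horner_prod /lagrange.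
  rewrite /lagrange_weight mul1r [RHS]mulrC; congr (_ * _).
  by apply: eq_big => j; [rewrite !inE | rewrite !hornerE => _; ring].
rewrite /fd_weight lagE derive1n_horner derivnZ derivn_comp_shift hornerZ horner_comp.
rewrite hornerXsubC subrr horner_coef0 coef_derivn addn0 ffactnn.
rewrite coef_prod_XaddC ?cardP // esymN -[in LHS]mulr_natl.
by rewrite [LHS]mulrCA mulrA.
Qed.

(** * Error of the weights and of the approximation *)

Lemma approx_fl_lagrange_weight {R : realType} {u : R} {A : fp_arith u} {n : nat}
    {x : 'I_n.+1 -> R} {k : 'I_n.+1} {w : R} :
  0 < u < 1 -> injective x -> (forall j, fp_num A (x j)) ->
  fl_lagrange_weight A x k w ->
  approx A (2 * n) w (lagrange_weight x k) `|lagrange_weight x k|.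
Proof.
move=> u01 x_inj x_fp [d red ->]; apply: relerr_approx => //.
have [|r_gt0] := relerr_prod (p := 1) (e := fun j => x k - x j) u01 _ red.
  by move=> j _; apply: relerr_sub.
have sz : size [seq j <- enum 'I_n.+1 | j != k] = n.
  have -> : size [seq j <- enum 'I_n.+1 | j != k] = #|[set~ k]|.
    rewrite cardE enumT /enum_mem; congr size; apply: eq_filter => j.
    by rewrite !inE.
  by rewrite cardsC1 card_ord.
rewrite sz in r_gt0 *; rewrite big_filter big_enum_cond /= => dP.
have -> : (2 * n = (n * 2).-1.+1)%N by lia.
apply: relerr_inv => //; apply/prodf_neq0 => j jk.
by rewrite subr_eq0 (inj_eq x_inj) eq_sym.
Qed.

Lemma approx_fl_fd_weight {R : realType} {u : R} {A : fp_arith u} {n m : nat}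
    {x : 'I_n.+1 -> R} {zeta : R} {k : 'I_n.+1} {W : R} :
  0 < u < 1 -> (0 < n)%N -> (m <= n)%N -> injective x ->
  (forall j, fp_num A (x j)) -> fp_num A zeta -> fp_num A m`!%:R ->
  fl_fd_weight A x m zeta k W ->
  approx A (5 * n - m + 2) W (fd_weight x m zeta k)
    (m`!%:R * `|lagrange_weight x k| *
     esym [set~ k] (n - m) (fun j => `|x j - zeta|)).
Proof.
move=> u01 n0 mn x_inj x_fp zeta_fp fact_fp [w [w' [ww ww' WW]]].
have {}ww := approx_fl_lagrange_weight u01 x_inj x_fp ww.
pose e j := x (inord j) - zeta.
have ze j : (j <= n)%N -> approx A 1 (fl_shift A x zeta j) (e j) `|e j|.
  by move=> _; apply: approx_sub_exact.
have {ze}ww' := approx_fl_partial_coef u01 n0 mn ze ww'.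
have eE : (fun j : 'I_n.+1 => e j) = (fun j => x j - zeta).
  by apply/funext => j; rewrite /e inord_val.
have eE' : (fun j : 'I_n.+1 => `|e j|) = (fun j => `|x j - zeta|).
  by apply/funext => j; rewrite /e inord_val.
rewrite eE eE' in ww'.
have mm := approx_exact A 0 _ u01 fact_fp.
rewrite normr_nat in mm.
rewrite fd_weightE //.
set a := lagrange_weight x k in ww *; set b := _ ^+ _ * _ in ww' *.
set c := esym _ _ _ in ww' *.
pose p := nth 0%N [:: 0; 2 * n; 3 * n - m]%N.
pose cs := [:: m`!%:R; w; w'].
pose es := [:: m`!%:R; a; b]; pose Ms := [:: m`!%:R; `|a|; c].
have capprox : {in iota 0 3, forall i, approx A (p i) cs`_i es`_i Ms`_i}.
  by move=> i; rewrite !inE => /or3P[] /eqP ->.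
have := approx_prod u01 capprox WW.
rewrite !big_cons !big_nil !mulr1 !mulrA; apply: approx_mono => //.
by rewrite /p /=; lia.
Qed.

Theorem theorem6 (R : realType) (u : R) (A : fp_arith u) (n m : nat)
    (x : 'I_n.+1 -> R) (zeta : R) (f : R -> R)
    (u_itv : 0 < u < 1) (n_ge1 : (1 <= n)%N) (m_le_n : (m <= n)%N)
    (x_inj : injective x)
    (x_fp : forall j, fp_num A (x j))
    (zeta_fp : fp_num A zeta)
    (fx_fp : forall j, fp_num A (f (x j)))
    (fact_fp : fp_num A m`!%:R)
    (u_small : (6 * n - m + 4)%:R * u < 1)
    (W : 'I_n.+1 -> R) (W_computed : forall k, fl_fd_weight A x m zeta k (W k))
    (v : R) (v_computed : fl_fd_approx A W (fun k => f (x k)) v) :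
  `|v - \sum_(k < n.+1) fd_weight x m zeta k * f (x k)|
  <= gamma u (6 * n - m + 4) * (\big[Num.max/0]_(j < n.+1) `|f (x j)|) *
     \sum_(k < n.+1) m`!%:R * `|lagrange_weight x k| *
       esym [set~ k] (n - m) (fun j => `|x j - zeta|).
Proof.
set F := \big[_/_]_(_ < _) _.
pose M k := m`!%:R * `|lagrange_weight x k| *
  esym [set~ k] (n - m) (fun j => `|x j - zeta|).
have term_approx k : approx A (5 * n - m + 3) (fl A Mul (W k) (f (x k)))
    (fd_weight x m zeta k * f (x k)) (M k * `|f (x k)|).
  have Wk := approx_fl_fd_weight u_itv n_ge1 m_le_n x_inj x_fp zeta_fp fact_fp
    (W_computed k).
  have fk := approx_exact A 0 _ u_itv (fx_fp k).
  by apply: approx_mono (approx_mul u_itv Wk fk) => //; lia.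
have [_ _] := approx_sum u_itv (fun k _ => term_approx k) v_computed.
rewrite size_enum_ord /= !big_enum /=.
have -> : (5 * n - m + 3 + n = 6 * n - m + 3)%N by lia.
move/le_trans; apply.
rewrite -mulrA; apply: ler_pM.
- by rewrite subr_ge0 growth_ge1.
- apply: sumr_ge0 => k _; rewrite !mulr_ge0 //; exact: esym_norm_ge0.
- apply: le_trans (growth_le_gamma _ u_itv u_small).
  by rewrite lerD2r growth_mono //; lia.
- rewrite mulr_sumr; apply: ler_sum => k _; rewrite [leRHS]mulrC ler_wpM2l //.
    by rewrite !mulr_ge0 //; exact: esym_norm_ge0.
  by apply/bigmax_geP; right; exists k.
Qed.
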